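(* Let $H$ be a Hilbert space, $U\subset H$ a closed linear subspace, $W\subset H$ a closed affine subspace with direction subspace $V$, and $u^{(0)}\in U$. Assume that $\theta_{\mathrm f}=\theta_{\mathrm f}(U,V)>0$. Let $(u^{(n)})_{n\ge0}$ be defined by the recurrence $$r^{(n)}=u^{(n)}-P_UP_Wu^{(n)},\qquad u^{(n+1)}=u^{(n)}-\alpha_nr^{(n)},\qquad \alpha_n=\frac{\|r^{(n)}\|^2}{\|P_{V^\perp}r^{(n)}\|^2},\qquad n\ge0.$$ Then the error $e^{(n)}:=u^{(n)}-P_{M_{U,W}}u^{(0)}$ satisfies $$\|e^{(n)}\|\le\kappa\Big(1-\frac{2}{\kappa^2+1}\Big)^{n}\|e^{(0)}\|,\quad n\ge0,\qquad\text{where }\kappa:=\sin\theta_p/\sin\theta_{\mathrm f}.$$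
   Context: $P_S$ denotes the orthogonal projection onto a nonempty closed affine subspace $S$ of $H$. $M_{U,W}:=\{u\in U:\|u-P_Wu\|=\inf_{v\in U}\|v-P_Wv\|\}$, which is nonempty when $\theta_{\mathrm f}(U,V)>0$. The angle $\theta_p=\theta_p(U,V)\in[0,\pi/2]$ is $\theta_p:=\arcsin\|P_UP_{V^\perp}\|$. The Friedrichs angle $\theta_{\mathrm f}=\theta_{\mathrm f}(U,V)\in[0,\pi/2]$ is defined by $\cos\theta_{\mathrm f}:=\sup\{|\langle u,v\rangle|:u\in U_0,\ v\in V_0,\ \|u\|=\|v\|=1\}$, where $U_0:=U\cap(U\cap V)^\perp$ and $V_0:=V\cap(U\cap V)^\perp$ (the supremum of the empty set being $0$). The iteration is terminated as soon as $r^{(n)}=0$, in which case the sequence is regarded as constant from then on ($u^{(m)}=u^{(n)}$ for $m\ge n$). *)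

(* Defs.v *)
From HB Require Import structures.
From mathcomp Require Import all_boot all_order all_algebra.
From mathcomp Require Import sesquilinear complex.
From mathcomp Require Import all_classical all_reals all_analysis.
Set Implicit Arguments.
Unset Strict Implicit.
Unset Printing Implicit Defensive.
Import Order.TTheory GRing.Theory Num.Theory.
Import numFieldNormedType.Exports.
Local Open Scope classical_set_scope.
Local Open Scope ring_scope.

(* K is the field R or C = R[i], cnj its conjugation and re the real part.
   Norms of K-normed modules take values in K: re reads them as real numbers. *)
Inductive real_or_complex (R : realType) :
    forall K : numFieldType, (K -> K) -> (K -> R) -> Prop :=
| RealScalars : @real_or_complex R R idfun idfun
| ComplexScalars : @real_or_complex R R[i] conjc (@complex.Re R).

Section HilbertSpace.
Context {R : realType} {K : numFieldType} {cnj : K -> K} (re : K -> R).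
Context {H : completeNormedModType K} (ip : {dot H for cnj}).
Implicit Types (U V W S : set H) (x u v : H).

Definition hnorm x : R := re `|x|.

Definition orthocompl S : set H :=
  [set x | forall s, S s -> ip x s = 0].

Definition closed_linear_subspace U : Prop :=
  submod_closed (mem U) /\ closed U.

Definition closed_affine_subspace W V : Prop :=
  [/\ closed W, submod_closed (mem V) & exists w, W = [set w + v | v in V]].

(* The unique p in S with x - p orthogonal to the direction of S; the default
   value 0 is only taken if there is no such p, which does not happen when S is
   a nonempty closed affine subspace. *)
Definition orth_proj S x : H :=
  xget 0 [set p | S p /\ forall s, S s -> ip (x - p) (s - p) = 0].

Definition best_approx U W : set H :=
  [set u | U u /\
    hnorm (u - orth_proj W u) = inf [set hnorm (v - orth_proj W v) | v in U]].

Definition opnorm (f : H -> H) : R :=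
  sup [set hnorm (f x) | x in [set x | hnorm x <= 1]].

Definition theta_p U V : R := asin (opnorm (orth_proj U \o orth_proj (orthocompl V))).

(* reals.sup is 0 on the empty set *)
Definition cos_friedrichs U V : R :=
  sup [set c | exists u v,
    [/\ (U `&` orthocompl (U `&` V)) u, (V `&` orthocompl (U `&` V)) v,
        hnorm u = 1, hnorm v = 1 & c = re `|ip u v|]].

Definition theta_f U V : R := acos (cos_friedrichs U V).

End HilbertSpace.

(* Main.v *)
(* On U0 = U `&` (U `&` V)^_|_ the errors satisfy r n = A (e n) with
   A = P_U P_{V^_|_}, so the iteration is steepest descent for the energy
   <A e, e> = |P_{V^_|_} e|^2. Writing lam = sin^2 theta_f and
   Lam = sin^2 theta_p, one has lam <= A <= Lam on U0, hence
   (A - lam)(Lam - A) >= 0; tested on <A e, e> and combined with AM-GM, this is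
   Kantorovich's inequality, which contracts the energy by
   ((Lam - lam) / (Lam + lam))^2 at each step. Going back and forth between norm
   and energy costs the factor kappa = sqrt (Lam / lam). Scalars being real or
   complex, everything is expressed through the real inner product re <x, y>. *)
Require Import Defs.
From HB Require Import structures.
From mathcomp Require Import all_boot all_order all_algebra.
From mathcomp Require Import sesquilinear complex.
From mathcomp Require Import all_classical all_reals all_analysis.
From mathcomp Require Import ring lra.
Set Implicit Arguments.
Unset Strict Implicit.
Unset Printing Implicit Defensive.
Import Order.TTheory GRing.Theory Num.Theory.
Import numFieldNormedType.Exports.
Local Open Scope classical_set_scope.
Local Open Scope ring_scope.

(** All that is used of the scalars, so that the real and complex cases are separated only once.
    [inj] embeds the reals, and [cnjM_re] is what carries orthogonality for the real part of [ip]
    back to [ip] itself. *)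
Record real_part (R : realType) (K : numFieldType) (cnj : K -> K) (re : K -> R)
    (inj : {rmorphism R -> K}) : Prop := RealPart {
  re_additive : forall a b, re (a + b) = re a + re b;
  re_injM : forall t a, re (inj t * a) = t * re a;
  re_cnj : forall a, re (cnj a) = re a;
  cnjM_re : forall a, re (cnj a * a) = 0 -> a = 0;
  re_le_norm : forall a, re a <= re `|a|;
  re_ge0K : forall a, 0 <= a -> inj (re a) = a;
  inj_ge0 : forall t, (0 <= inj t) = (0 <= t) }.

Lemma real_or_complex_real_part (R : realType) (K : numFieldType)
    (cnj : K -> K) (re : K -> R) :
  real_or_complex cnj re -> exists inj, real_part cnj re inj.
Proof.
case=> [|].
  exists idfun; split => //=.
  - by move=> a /eqP; rewrite mulf_eq0 orbb => /eqP.
  - exact: ler_norm.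
exists (real_complex R); split.
- by move=> [a b] [c d].
- by move=> t [a b] /=; rewrite mul0r subr0.
- by case.
- move=> [a b] /=; rewrite mulNr opprK => /eqP.
  rewrite paddr_eq0 ?sqr_ge0 -?expr2 ?sqrf_eq0// ?sqr_ge0//.
  by move=> /andP[/eqP -> /eqP ->].
- move=> a; rewrite normc_def /=.
  rewrite (le_trans (ler_norm _))// -sqrtr_sqr ler_wsqrtr//.
  by rewrite lerDl sqr_ge0.
- by move=> a a0; apply: RRe_real; rewrite ger0_real.
- exact: ler0c.
Qed.

(** * The real inner product and its norm *)

Section RealPart.
Context {R : realType} {K : numFieldType} {cnj : K -> K} {re : K -> R}.
Context {inj : {rmorphism R -> K}} (reP : real_part cnj re inj).
Context {H : completeNormedModType K} {ip : {dot H for cnj}}.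
Hypothesis ip_norm : forall x : H, `|x| ^+ 2 = ip x x.
Implicit Types (x y z : H) (S : set H).

Local Notation hnorm := (hnorm re).

Definition rdot x y : R := re (ip x y).

Lemma re_inj t : re (inj t) = t.
Proof.
have re1 : re 1 = 1.
  by apply: (fmorph_inj inj); rewrite (re_ge0K reP) ?ler01// rmorph1.
by rewrite -[inj t]mulr1 (re_injM reP) re1 mulr1.
Qed.

Lemma re0 : re 0 = 0. Proof. by rewrite -(rmorph0 inj) re_inj. Qed.

Lemma reN a : re (- a) = - re a.
Proof. by rewrite -mulN1r -(rmorph1 inj) -rmorphN (re_injM reP) mulN1r. Qed.

Lemma re_ge0 a : 0 <= a -> 0 <= re a.
Proof. by move=> a0; rewrite -(inj_ge0 reP) (re_ge0K reP). Qed.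

Lemma inj_le s t : (inj s <= inj t) = (s <= t).
Proof. by rewrite -subr_ge0 -rmorphB (inj_ge0 reP) subr_ge0. Qed.

Lemma inj_lt s t : (inj s < inj t) = (s < t).
Proof. by rewrite !lt_neqAle inj_le (inj_eq (fmorph_inj inj)). Qed.

Lemma inj_hnorm x : inj (hnorm x) = `|x|.
Proof. by rewrite (re_ge0K reP). Qed.

Lemma rdotC x y : rdot x y = rdot y x.
Proof. by rewrite /rdot hermitian_subproof mul1r (re_cnj reP). Qed.

Lemma rdotDl x y z : rdot (x + y) z = rdot x z + rdot y z.
Proof. by rewrite /rdot linearDl (re_additive reP). Qed.

Lemma rdotNl x z : rdot (- x) z = - rdot x z.
Proof. by rewrite /rdot linearNl reN. Qed.

Lemma rdotZl t x z : rdot (inj t *: x) z = t * rdot x z.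
Proof. by rewrite /rdot linearZl_LR (re_injM reP). Qed.

Lemma rdotDr x y z : rdot z (x + y) = rdot z x + rdot z y.
Proof. by rewrite ![rdot z _]rdotC rdotDl. Qed.

Lemma rdotNr x z : rdot z (- x) = - rdot z x.
Proof. by rewrite ![rdot z _]rdotC rdotNl. Qed.

Lemma rdotZr t x z : rdot z (inj t *: x) = t * rdot z x.
Proof. by rewrite ![rdot z _]rdotC rdotZl. Qed.

Lemma rdot0l z : rdot 0 z = 0.
Proof. by rewrite /rdot linear0l re0. Qed.

Lemma rdot0r z : rdot z 0 = 0.
Proof. by rewrite rdotC rdot0l. Qed.

Definition rdotE := (rdotDl, rdotDr, rdotNl, rdotNr, rdotZl, rdotZr).

Lemma rdot_sqrD x y :
  rdot (x + y) (x + y) = rdot x x + 2 * rdot x y + rdot y y.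
Proof. by rewrite !rdotE (rdotC y x); ring. Qed.

Lemma rdot_subZ t x y : rdot (x - inj t *: y) (x - inj t *: y) =
  rdot x x - 2 * t * rdot x y + t ^+ 2 * rdot y y.
Proof. by rewrite !rdotE (rdotC y x); ring. Qed.

Lemma hnorm_ge0 x : 0 <= hnorm x.
Proof. exact: re_ge0. Qed.

Lemma hnorm_sqr x : hnorm x ^+ 2 = rdot x x.
Proof.
by rewrite /rdot -ip_norm -(inj_hnorm x) -rmorphXn re_inj.
Qed.

Lemma rdot_ge0 x : 0 <= rdot x x.
Proof. by rewrite -hnorm_sqr sqr_ge0. Qed.

Lemma inj_rdot x : inj (rdot x x) = `|x| ^+ 2.
Proof. by rewrite -hnorm_sqr rmorphXn inj_hnorm. Qed.

Lemma rdot_eq0 x : rdot x x = 0 -> x = 0.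
Proof.
move=> x0; apply/eqP; rewrite -normr_eq0 -sqrf_eq0 -inj_rdot x0.
by rewrite rmorph0.
Qed.

Lemma hnorm0 : hnorm (0 : H) = 0.
Proof. by rewrite /Defs.hnorm normr0 re0. Qed.

Lemma hnorm_eq0 x : hnorm x = 0 -> x = 0.
Proof. by move=> x0; apply: rdot_eq0; rewrite -hnorm_sqr x0 expr0n. Qed.

Lemma hnormZ t x : hnorm (inj t *: x) = `|t| * hnorm x.
Proof.
apply/eqP; rewrite -(@eqrXn2 _ 2)// ?mulr_ge0 ?hnorm_ge0//.
by rewrite exprMn !hnorm_sqr !rdotE real_normK ?num_real//; apply/eqP; ring.
Qed.

Lemma hnormD x y : hnorm (x + y) <= hnorm x + hnorm y.
Proof. by rewrite -inj_le rmorphD !inj_hnorm ler_normD. Qed.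

Lemma hnormN x : hnorm (- x) = hnorm x.
Proof. by rewrite /Defs.hnorm normrN. Qed.

Lemma hnorm_leP x y : (hnorm x <= hnorm y) = (rdot x x <= rdot y y).
Proof. by rewrite -!hnorm_sqr ler_pXn2r ?nnegrE ?hnorm_ge0. Qed.

(** Cauchy-Schwarz: the squared norm of |y| x - |x| y is nonnegative and equals 2 |x| |y| (|x| |y| -
    <x, y>). *)
Lemma rdot_le x y : rdot x y <= hnorm x * hnorm y.
Proof.
have pos z : z != 0 -> 0 < hnorm z.
  move=> z0; rewrite lt_neqAle hnorm_ge0 andbT eq_sym.
  by apply: contra z0 => /eqP/hnorm_eq0 ->.
have [->|y0] := eqVneq y 0; first by rewrite rdot0r hnorm0 mulr0.
have [->|x0] := eqVneq x 0; first by rewrite rdot0l hnorm0 mul0r.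
rewrite -subr_ge0 -(pmulr_rge0 _ (mulr_gt0 (pos x x0) (pos y y0))).
have := rdot_ge0 (inj (hnorm y) *: x - inj (hnorm x) *: y).
rewrite !rdotE (rdotC y x) -!hnorm_sqr => h.
by nra.
Qed.

Lemma rdot_norm_le x y : `|rdot x y| <= hnorm x * hnorm y.
Proof.
by rewrite ler_norml rdot_le andbT lerNl -rdotNl -[hnorm x]hnormN rdot_le.
Qed.

Lemma hnorm_ip_le x y : re `|ip x y| <= hnorm x * hnorm y.
Proof.
(* A unit scalar rotates [ip x y] onto the real axis. *)
have [xy0|xy0] := eqVneq (ip x y) 0.
  by rewrite xy0 normr0 re0 mulr_ge0 ?hnorm_ge0.
have := rdot_le ((`|ip x y| / ip x y) *: x) y.
rewrite /rdot linearZl_LR/= divfK//; congr (_ <= _ * _).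
by rewrite /Defs.hnorm normrZ normf_div normr_id divff ?mul1r ?normr_eq0.
Qed.

Lemma rdot_le_ip x y : rdot x y <= re `|ip x y|.
Proof. exact: (re_le_norm reP). Qed.

(** The subspace also contains [ip x s *: s], and the real product of [x] with it is the squared
    modulus of [ip x s]. *)
Lemma ip_eq0 S x : submod_closed (mem S) ->
  (forall s, S s -> rdot x s = 0) -> forall s, S s -> ip x s = 0.
Proof.
move=> [S0 Slin] x0 s Ss; apply: (cnjM_re reP).
have /x0 : S (ip x s *: s).
  by have := Slin (ip x s) s 0; rewrite addr0 !inE; apply => //; rewrite -inE.
by rewrite /rdot linearZr_LR.
Qed.

(** * Closedness, completeness and minimisers in terms of real distances *)

Definition dclosed S :=
  forall x, (forall eps : R, 0 < eps -> exists2 s, S s & hnorm (x - s) < eps) ->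
    S x.

(** The balls of [H] have radii in [K], but a positive radius is [inj] of its real part, so real
    radii suffice. *)
Lemma closed_dclosed S : closed S -> dclosed S.
Proof.
move=> cS x xS; apply: cS => B /nbhs_ballP[e /= e0 eB].
have re0' : 0 < re e by rewrite -inj_lt rmorph0 (re_ge0K reP)// ltW.
have [s Ss xs] := xS _ re0'; exists s; split => //; apply: eB.
rewrite -ball_normE /=.
by rewrite -inj_hnorm -[ltRHS](re_ge0K reP (ltW e0)) inj_lt.
Qed.

Lemma dist_complete (x : nat -> H) :
  (forall eps : R, 0 < eps -> exists N, forall n m, (N <= n)%N -> (N <= m)%N ->
     hnorm (x n - x m) < eps) ->
  exists l, forall eps : R, 0 < eps -> exists N, forall n, (N <= n)%N ->
     hnorm (l - x n) < eps.
Proof.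
move=> xC.
have : cvgn x.
  apply: cauchy_cvg; apply: cauchy_exP => e e0.
  have re0' : 0 < re e by rewrite -inj_lt rmorph0 (re_ge0K reP)// ltW.
  have [N xN] := xC _ re0'; exists (x N), N => // n /= Nn.
  rewrite -ball_normE /= -inj_hnorm -[ltRHS](re_ge0K reP (ltW e0)) inj_lt.
  exact: xN.
move=> xl; exists (limn x) => eps eps0.
have ie0 : 0 < inj eps by rewrite -(rmorph0 inj) inj_lt.
have [N _ lN] := (proj1 (cvgrPdist_lt _ _)) xl _ ie0.
exists N => n Nn; rewrite -inj_lt inj_hnorm; exact: lN.
Qed.

(* The parallelogram law at midpoints makes the images under [g] of a minimising
   sequence Cauchy, hence the sequence itself by coercivity. *)
Lemma exists_minimizer S (g : H -> H) (lam : R) : 0 < lam ->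
  S !=set0 -> dclosed S ->
  (forall x y, S x -> S y -> S (inj 2^-1 *: (x + y))) ->
  (forall x y, S x -> S y ->
    g (inj 2^-1 *: (x + y)) = inj 2^-1 *: (g x + g y)) ->
  (forall x y, S x -> S y -> lam * hnorm (x - y) <= hnorm (g x - g y)) ->
  (forall x y, hnorm (g x - g y) <= hnorm (x - y)) ->
  exists2 p, S p & forall s, S s -> hnorm (g p) <= hnorm (g s).
Proof.
move=> lam0 [s0 Ss0] clS midS midg coer lip.
pose E := [set hnorm (g s) | s in S].
have lbE : lbound E 0 by move=> _ [s _ <-]; exact: hnorm_ge0.
have infE : has_inf E by split; [exists (hnorm (g s0)), s0|exists 0].
set d := inf E.
have dE s : S s -> d <= hnorm (g s).
  by move=> Ss; apply: ge_inf; [exists 0|exists s].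
have d0 : 0 <= d by apply: lb_le_inf => //; exists (hnorm (g s0)), s0.
have exs (n : nat) : exists s, S s /\ hnorm (g s) < d + n.+1%:R^-1.
  have n0 : 0 < n.+1%:R^-1 :> R by rewrite invr_gt0 ltr0n.
  by have [_ [s Ss <-] ds] := inf_adherent n0 infE; exists s.
pose x n := projT1 (cid (exs n)).
have xP n : S (x n) /\ hnorm (g (x n)) < d + n.+1%:R^-1 := projT2 (cid (exs n)).
(* The midpoint has norm at least [d], so the parallelogram law bounds the left side by 4 (d + e)^2
   - 4 d^2 = 8 d e + 4 e^2, and e <= 1. *)
have gap a b (e : R) : 0 < e -> e <= 1 -> S a -> S b -> hnorm (g a) < d + e ->
    hnorm (g b) < d + e -> hnorm (g a - g b) ^+ 2 <= (8 * d + 4) * e.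
  move=> e0 e1 Sa Sb ga gb.
  have := dE _ (midS _ _ Sa Sb); rewrite midg// => gm.
  have : d ^+ 2 <= hnorm (inj 2^-1 *: (g a + g b)) ^+ 2.
    by rewrite ler_pXn2r// nnegrE hnorm_ge0.
  have : hnorm (g a) ^+ 2 <= (d + e) ^+ 2.
    by rewrite ler_pXn2r ?ltW// nnegrE ?hnorm_ge0// addr_ge0// ltW.
  have : hnorm (g b) ^+ 2 <= (d + e) ^+ 2.
    by rewrite ler_pXn2r ?ltW// nnegrE ?hnorm_ge0// addr_ge0// ltW.
  by rewrite !hnorm_sqr !rdotE (rdotC (g b) (g a)); nra.
have inv_small (e : R) : 0 < e ->
    exists N : nat, forall n, (N <= n)%N -> n.+1%:R^-1 < e.
  move=> e0; exists (Num.truncn e^-1) => n Nn.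
  rewrite invf_plt ?posrE ?ltr0n//.
  apply: lt_le_trans (truncnS_gt _) _.
  by rewrite ler_nat.
have [|l lP] := dist_complete (x := x).
  move=> eps eps0.
  (* Chosen so that (8 d + 4) e < (lam eps)^2; the 5 in place of 4 makes this strict. *)
  set e := Num.min 1 ((lam * eps) ^+ 2 / (8 * d + 5)).
  have e0 : 0 < e.
    by rewrite lt_min ltr01 divr_gt0 ?exprn_gt0 ?mulr_gt0//; lra.
  have [N NP] := inv_small _ e0; exists N => n m Nn Nm.
  have [[Sn gn] [Sm gm]] := (xP n, xP m).
  have h := gap _ _ _ e0 _ Sn Sm (lt_trans gn _) (lt_trans gm _).
  have {}h : hnorm (g (x n) - g (x m)) ^+ 2 <= (8 * d + 4) * e.
    by apply: h; rewrite ?ltrD2l ?NP// /e ge_min lexx.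
  have : lam * hnorm (x n - x m) < lam * eps; last by rewrite ltr_pM2l.
  apply: le_lt_trans (coer _ _ Sn Sm) _.
  rewrite -(@ltr_pXn2r _ 2)// ?nnegrE ?hnorm_ge0 ?mulr_ge0 ?ltW//.
  have : e <= (lam * eps) ^+ 2 / (8 * d + 5) by rewrite /e ge_min lexx orbT.
  by rewrite ler_pdivlMr; lra.
have Sl : S l.
  apply: clS => eps /lP[N NP]; exists (x N); [exact: (xP N).1|exact: NP].
exists l => // s /dE; apply: le_trans.
(* At a late index [x] is within e/2 of [l], and the norm of its image under [g] is within e/2 of
   [d]. *)
apply/ler_addgt0Pr => e e0.
have e20 : 0 < e / 2 by lra.
have [[N NP] [M MP]] := (lP _ e20, inv_small _ e20).
have xd := (xP (maxn N M)).2.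
have := MP _ (leq_maxr N M); have := NP _ (leq_maxl N M).
have := lip l (x (maxn N M)).
have := hnormD (g l - g (x (maxn N M))) (g (x (maxn N M))); rewrite subrK.
move: xd; move: (_.+1%:R^-1) => y.
lra.
Qed.

Lemma minimizer_orthogonal x h :
  (forall t, hnorm x <= hnorm (x + inj t *: h)) -> rdot x h = 0.
Proof.
move=> xh.
have [/eqP|h0] := eqVneq (rdot h h) 0.
  by move=> /eqP/rdot_eq0 ->; rewrite rdot0r.
have hh : 0 < rdot h h by rewrite lt_neqAle eq_sym h0 rdot_ge0.
(* The best point on the line: it lowers the squared norm by <x, h>^2 / <h, h>, which must therefore
   vanish. *)
have := xh (- (rdot x h / rdot h h)).
rewrite hnorm_leP !rdotE (rdotC h x).
set a := rdot x h; set b := rdot h h.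
have -> : rdot x x + - (a / b) * a +
    (- (a / b) * a + - (a / b) * (- (a / b) * b)) = rdot x x - a ^+ 2 / b by field.
rewrite -subr_ge0 addrC addKr oppr_ge0 => ab.
have : a ^+ 2 / b = 0 by apply/eqP; rewrite eq_le ab divr_ge0 ?sqr_ge0// ltW.
by move/eqP; rewrite mulf_eq0 sqrf_eq0 invr_eq0 (negPf h0) orbF => /eqP.
Qed.

(** * Linear subspaces and orthogonal complements *)

Lemma submod0 S : submod_closed (mem S) -> S 0.
Proof. by case=> S0 _; rewrite -inE. Qed.

Lemma submodZD S a x y : submod_closed (mem S) -> S x -> S y -> S (a *: x + y).
Proof. by case=> _ Slin Sx Sy; rewrite -inE; apply: Slin; rewrite inE. Qed.

Lemma submodZ S a x : submod_closed (mem S) -> S x -> S (a *: x).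
Proof.
move=> Slin Sx; rewrite -[_ *: _]addr0.
by apply: submodZD => //; exact: submod0.
Qed.

Lemma submodD S x y : submod_closed (mem S) -> S x -> S y -> S (x + y).
Proof. by move=> Slin Sx Sy; rewrite -[x]scale1r; apply: submodZD. Qed.

Lemma submodB S x y : submod_closed (mem S) -> S x -> S y -> S (x - y).
Proof.
move=> Slin Sx Sy; apply: submodD => //.
by rewrite -scaleN1r; apply: submodZ.
Qed.

Lemma submodI S1 S2 : submod_closed (mem S1) -> submod_closed (mem S2) ->
  submod_closed (mem (S1 `&` S2)).
Proof.
move=> lin1 lin2; split; first by rewrite inE; split; exact: submod0.
move=> a x y; rewrite !inE => -[S1x S2x] [S1y S2y].
by split; apply: submodZD.
Qed.

Lemma dclosedI S1 S2 : dclosed S1 -> dclosed S2 -> dclosed (S1 `&` S2).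
Proof.
move=> cl1 cl2 x xS.
by split; [apply: cl1|apply: cl2] => e /xS[s [? ?] ?]; exists s.
Qed.

Lemma orthocompl_rdot S x y : orthocompl ip S x -> S y -> rdot x y = 0.
Proof. by move=> xS /xS; rewrite /rdot => ->; exact: re0. Qed.

Lemma submod_orthocompl S : submod_closed (mem (orthocompl ip S)).
Proof.
split; first by rewrite inE => s _; rewrite linear0l.
move=> a x y; rewrite !inE => xS yS s Ss.
by rewrite linearDl linearZl_LR/= xS// yS// mulr0 addr0.
Qed.

Lemma dclosed_orthocompl S : submod_closed (mem S) ->
  dclosed (orthocompl ip S).
Proof.
move=> Slin x xS; move=> t; apply: (ip_eq0 Slin) => {t} s Ss.
apply/eqP; rewrite -normr_le0; apply/ler_addgt0Pr => e e0; rewrite add0r.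
(* Adding 1 keeps the divisor positive when [s] is 0. *)
have s0 : 0 < hnorm s + 1 by rewrite ltr_wpDl// hnorm_ge0.
have [y yS xy] := xS _ (divr_gt0 e0 s0).
have -> : rdot x s = rdot (x - y) s.
  by rewrite rdotDl rdotNl (orthocompl_rdot yS Ss) subr0.
apply: le_trans (rdot_norm_le _ _) _.
have : hnorm (x - y) * (hnorm s + 1) <= e by rewrite -ler_pdivlMr// ltW.
by have := hnorm_ge0 (x - y); lra.
Qed.

(** * Orthogonal projections *)

Lemma orth_proj_unique S x p : S p ->
  (forall s, S s -> ip (x - p) (s - p) = 0) -> orth_proj ip S x = p.
Proof.
move=> Sp pS; apply: xget_unique; first by split.
move=> q [Sq qS]; apply/eqP; rewrite -subr_eq0; apply/eqP/rdot_eq0.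
(* Both candidates are tested against [q - p]; the difference of the two equations is |q - p|^2 =
   0. *)
have pq : rdot (x - p) (q - p) = 0 by rewrite /rdot pS// re0.
have qp : rdot (x - q) (q - p) = 0.
  by rewrite -(opprB p q) rdotNr /rdot qS// re0 oppr0.
have -> : rdot (q - p) (q - p) = rdot (x - p) (q - p) - rdot (x - q) (q - p).
  by rewrite -rdotNl -rdotDl; congr (rdot _ _); rewrite opprB [RHS]addrC subrKA.
by rewrite pq qp subrr.
Qed.

(** A point of [S] nearest to [x] exists, and varying it along [D] shows that it is the projection.
    So the default value in [orth_proj] is never taken. *)
Lemma affine_orth_projP S D w x : submod_closed (mem D) -> dclosed S ->
    S = [set w + v | v in D] ->
  S (orth_proj ip S x) /\
  forall v, D v -> rdot (x - orth_proj ip S x) v = 0.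
Proof.
move=> Dlin clS SE.
have SD p q : S p -> D q -> S (p + q).
  rewrite SE => -[v Dv <-] Dq; exists (v + q); first exact: submodD.
  by rewrite addrA.
have SB p q : S p -> S q -> D (p - q).
  rewrite SE => -[v Dv <-] [v' Dv' <-].
  by rewrite opprD addrACA subrr add0r; exact: submodB.
have half y z : inj 2^-1 *: (y + z) = y + inj 2^-1 *: (z - y).
  have -> : y + z = inj 2 *: y + (z - y).
    by rewrite rmorph_nat scaler_nat mulr2n addrACA subrr addr0.
  by rewrite scalerDr scalerA -rmorphM mulVf ?pnatr_eq0// rmorph1 scale1r.
(* The translation by [- x] is an isometry, hence coercive with constant 1. *)
have [||y z Sy Sz|y z Sy Sz|y z _ _|y z|p Sp pS] :=
    @exists_minimizer S (fun y => y - x) 1 ltr01.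
- by exists w; rewrite SE; exists 0; [exact: submod0|rewrite addr0].
- exact: clS.
- by rewrite half; apply: SD => //; apply: submodZ => //; exact: SB.
- rewrite [in LHS]half addrAC [RHS]half; congr (_ + _ *: _).
  by rewrite opprB addrA subrK.
- by rewrite mul1r opprB addrA subrK.
- by rewrite opprB addrA subrK.
have orth v : D v -> rdot (x - p) v = 0.
  move=> Dv; rewrite -opprB rdotNl minimizer_orthogonal ?oppr0// => t.
  rewrite addrAC; apply: pS; apply: SD => //; exact: submodZ.
suff -> : orth_proj ip S x = p by split.
apply: orth_proj_unique => // s Ss.
by apply: (ip_eq0 Dlin orth); exact: SB.
Qed.

Section Subspace.
Variable S : set H.
Hypotheses (Slin : submod_closed (mem S)) (Scl : dclosed S).
Local Notation P := (orth_proj ip S).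

Lemma projP x : S (P x) /\ forall s, S s -> rdot (x - P x) s = 0.
Proof.
apply: (@affine_orth_projP _ _ 0) => //.
by rewrite -[LHS]image_id; apply: eq_imagel => s _; rewrite add0r.
Qed.

Lemma proj_in x : S (P x). Proof. exact: (projP x).1. Qed.

Lemma proj_orth x s : S s -> rdot (x - P x) s = 0.
Proof. exact: (projP x).2. Qed.

Lemma proj_unique x p : S p -> (forall s, S s -> rdot (x - p) s = 0) -> P x = p.
Proof.
move=> Sp pS; apply: orth_proj_unique => // s Ss.
by apply: (ip_eq0 Slin pS); exact: submodB.
Qed.

Lemma proj_id x : S x -> P x = x.
Proof. by move=> Sx; apply: proj_unique => // s _; rewrite subrr rdot0l. Qed.

Lemma projD x y : P (x + y) = P x + P y.
Proof.
apply: proj_unique; first by apply: submodD => //; exact: proj_in.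
by move=> s Ss; rewrite opprD addrACA rdotDl !proj_orth// addr0.
Qed.

Lemma projZ t x : P (inj t *: x) = inj t *: P x.
Proof.
apply: proj_unique; first by apply: submodZ => //; exact: proj_in.
by move=> s Ss; rewrite -scalerBr rdotZl proj_orth// mulr0.
Qed.

Lemma projN x : P (- x) = - P x.
Proof. by have := projZ (-1) x; rewrite rmorphN rmorph1 !scaleN1r. Qed.

Lemma projB x y : P (x - y) = P x - P y.
Proof. by rewrite projD projN. Qed.

Lemma proj_dotl x s : S s -> rdot (P x) s = rdot x s.
Proof.
by move=> Ss; apply/eqP; rewrite eq_sym -subr_eq0 -rdotNl -rdotDl proj_orth.
Qed.

Lemma proj_dotr x s : S s -> rdot s (P x) = rdot s x.
Proof. by move=> Ss; rewrite rdotC proj_dotl// rdotC. Qed.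

Lemma proj_compl x : orth_proj ip (orthocompl ip S) x = x - P x.
Proof.
have orthP : orthocompl ip S (x - P x).
  by move=> s; apply: (ip_eq0 Slin) => {}s; exact: proj_orth.
apply: orth_proj_unique => // y yS; rewrite subKr.
apply: (ip_eq0 (submod_orthocompl S) _
         (submodB (submod_orthocompl S) yS orthP)).
by move=> z zS; rewrite rdotC; apply: orthocompl_rdot zS _; exact: proj_in.
Qed.

Lemma hnorm_proj x : hnorm (P x) <= hnorm x.
Proof.
have := proj_orth x (proj_in x); have := rdot_ge0 (x - P x).
by rewrite hnorm_leP !rdotE (rdotC (P x) x); lra.
Qed.

End Subspace.

(** * The two angles as bounds on the product of projections *)

Section FriedrichsAngle.
Context {U V : set H}.
Hypotheses (Ulin : submod_closed (mem U)) (Ucl : dclosed U).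
Hypotheses (Vlin : submod_closed (mem V)) (Vcl : dclosed V).

Local Notation P := (orth_proj ip U).
Local Notation U0 := (U `&` orthocompl ip (U `&` V)).

Let Nlin : submod_closed (mem (U `&` V)) := submodI Ulin Vlin.
Let Ncl : dclosed (U `&` V) := dclosedI Ucl Vcl.
Let U0lin : submod_closed (mem U0) :=
  submodI Ulin (submod_orthocompl (U `&` V)).
Let U0cl : dclosed U0 := dclosedI Ucl (dclosed_orthocompl Nlin).

(** By [proj_compl], the projection onto the orthogonal complement of [V]. *)
Definition proj_perp x := x - orth_proj ip V x.
Local Notation Q := proj_perp.

Lemma proj_perpB x y : Q (x - y) = Q x - Q y.
Proof.
rewrite /Q projB// !opprB [LHS]addrACA [RHS]addrACA; congr (_ + _).
exact: addrC.
Qed.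

Lemma proj_perpZ t x : Q (inj t *: x) = inj t *: Q x.
Proof. by rewrite /Q projZ// scalerBr. Qed.

Lemma proj_perpD x y : Q (x + y) = Q x + Q y.
Proof. by rewrite /Q projD// opprD addrACA. Qed.

Lemma proj_perp_eq0 x : V x -> Q x = 0.
Proof. by move=> Vx; rewrite /Q proj_id// subrr. Qed.

Lemma proj_perp_dot x v : V v -> rdot (Q x) v = 0.
Proof. exact: proj_orth. Qed.

Lemma proj_perp_sym x y : rdot (Q x) y = rdot (Q x) (Q y).
Proof.
by rewrite /Q rdotDr rdotNr (proj_perp_dot _ (proj_in Vlin Vcl y)) subr0.
Qed.

Lemma proj_perpK x : Q (Q x) = Q x.
Proof.
have QV0 : orth_proj ip V (Q x) = 0.
  apply: proj_unique => //; first exact: submod0.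
  by move=> s Vs; rewrite subr0 proj_perp_dot.
by rewrite -[RHS]subr0 -QV0.
Qed.

Lemma proj_perp_pythagoras x :
  rdot (Q x) (Q x) + rdot (orth_proj ip V x) (orth_proj ip V x) = rdot x x.
Proof.
rewrite -proj_perp_sym rdotC proj_dotl//; last exact: proj_in.
by rewrite -rdotDr subrK.
Qed.

Lemma hnorm_proj_perp x : hnorm (Q x) <= hnorm x.
Proof. by rewrite hnorm_leP -(proj_perp_pythagoras x) lerDl rdot_ge0. Qed.

(** On [U] this is Q^* Q for the restriction of [Q] to [U]: by [normal_op_dot] its quadratic form is
    the energy |Q x|^2. *)
Definition normal_op x := P (Q x).
Local Notation A := normal_op.

Lemma normal_opB x y : A (x - y) = A x - A y.
Proof. by rewrite /A proj_perpB projB. Qed.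

Lemma normal_opZ t x : A (inj t *: x) = inj t *: A x.
Proof. by rewrite /A proj_perpZ projZ. Qed.

(** Against a vector of both [U] and [V] the outer projection drops out, and [Q x] is orthogonal to
    [V]. Thus corrections by [A] never leave [U0], the space where [A] is coercive. *)
Lemma normal_op_in x : U0 (A x).
Proof.
split; first exact: proj_in.
move=> t; apply: (ip_eq0 Nlin) => {t} s [Us Vs].
by rewrite proj_dotl// proj_perp_dot.
Qed.

Lemma normal_op_dot x y : U y -> rdot (A x) y = rdot (Q x) (Q y).
Proof. by move=> Uy; rewrite proj_dotl// proj_perp_sym. Qed.

Local Notation c := (cos_friedrichs re ip U V).
Local Notation sp := (opnorm re (P \o orth_proj ip (orthocompl ip V))).

Let cosines := [set c | exists u v,
    [/\ U0 u, (V `&` orthocompl ip (U `&` V)) v,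
        hnorm u = 1, hnorm v = 1 & c = re `|ip u v|]].

Lemma cosines_ub : ubound cosines 1.
Proof.
move=> _ [x [y [_ _ x1 y1 ->]]].
by apply: le_trans (hnorm_ip_le _ _) _; rewrite x1 y1 mulr1.
Qed.

Lemma cos_friedrichs_itv : 0 <= c <= 1.
Proof.
rewrite -[c]/(sup cosines).
(* There may be no pair of unit vectors at all; the supremum is then 0. *)
have [->|/set0P[k kcos]] := eqVneq cosines set0.
  by rewrite sup0 lexx ler01.
apply/andP; split; last first.
  by apply: ge_sup; [exists k|exact: cosines_ub].
apply: le_trans (_ : k <= _).
  by case: kcos => [x [y [_ _ _ _ ->]]]; exact: re_ge0.
by apply: ub_le_sup => //; exists 1; exact: cosines_ub.
Qed.

(** The projection y of x onto [V] is again orthogonal to the intersection of [U] and [V], and <x,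
    y> = |y|^2, so |y| / |x| is bounded by one of the cosines whose supremum is [c]. *)
Lemma hnorm_proj_le_cos x : U0 x -> hnorm (orth_proj ip V x) <= c * hnorm x.
Proof.
move=> U0x; set y := orth_proj ip V x.
have /andP[c0 _] := cos_friedrichs_itv.
have [->|y0] := eqVneq y 0; first by rewrite hnorm0 mulr_ge0 ?hnorm_ge0.
have x0 : x != 0.
  by apply: contra y0 => /eqP x0; rewrite /y x0 proj_id//; exact: submod0.
have pos z : z != 0 -> 0 < hnorm z.
  move=> z0; rewrite lt_neqAle hnorm_ge0 andbT eq_sym.
  by apply: contra z0 => /eqP/hnorm_eq0 ->.
have [nx ny] := (pos _ x0, pos _ y0).
have normed z : z != 0 -> hnorm (inj (hnorm z)^-1 *: z) = 1.
  move=> /pos z0; rewrite hnormZ ger0_norm ?invr_ge0 ?hnorm_ge0//.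
  by rewrite mulVf// gt_eqF.
have Vy : V y := proj_in Vlin Vcl x.
have V0y : (V `&` orthocompl ip (U `&` V)) y.
  split=> // t; apply: (ip_eq0 Nlin) => {t} s [Us Vs].
  by rewrite proj_dotl//; exact: orthocompl_rdot U0x.2 _.
have xy : rdot (inj (hnorm x)^-1 *: x) (inj (hnorm y)^-1 *: y) =
    (hnorm x)^-1 * hnorm y.
  rewrite !rdotE -(proj_dotl Vlin Vcl)// -/y -hnorm_sqr; congr (_ * _).
  by rewrite expr2 mulrA mulVf ?mul1r// gt_eqF.
rewrite -ler_pdivrMr// mulrC -xy.
apply: le_trans (rdot_le_ip _ _) _.
apply: ub_le_sup; first by exists 1; exact: cosines_ub.
exists (inj (hnorm x)^-1 *: x), (inj (hnorm y)^-1 *: y); split => //.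
- exact: submodZ.
- by apply: submodZ => //; apply: submodI => //; exact: submod_orthocompl.
- exact: normed.
- exact: normed.
Qed.

(** Pythagoras turns the bound on the part in [V] into a lower bound on the rest, with constant
    sin^2 theta_f. *)
Lemma proj_perp_coercive x : U0 x ->
  (1 - c ^+ 2) * rdot x x <= rdot (Q x) (Q x).
Proof.
move=> U0x; have /andP[c0 _] := cos_friedrichs_itv.
have : hnorm (orth_proj ip V x) ^+ 2 <= (c * hnorm x) ^+ 2.
  by rewrite ler_pXn2r ?nnegrE ?mulr_ge0 ?hnorm_ge0// hnorm_proj_le_cos.
rewrite exprMn !hnorm_sqr; have := proj_perp_pythagoras x; lra.
Qed.

Let normal_op_opnorm : P \o orth_proj ip (orthocompl ip V) = A.
Proof. by apply/funext => x /=; rewrite proj_compl. Qed.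

Let norms := [set hnorm (A x) | x in [set x | hnorm x <= 1]].

Lemma norms_ub : ubound norms 1.
Proof.
move=> _ [x /= x1 <-]; apply: le_trans x1.
by apply: le_trans (hnorm_proj_perp x); exact: hnorm_proj.
Qed.

Lemma opnorm_itv : 0 <= sp <= 1.
Proof.
rewrite normal_op_opnorm -[opnorm _ _]/(sup norms).
have norms0 : norms (hnorm (A 0)) by exists 0; rewrite //= hnorm0 ler01.
apply/andP; split; last by apply: ge_sup norms_ub; exists (hnorm (A 0)).
apply: le_trans (hnorm_ge0 (A 0)) _.
by apply: ub_le_sup => //; exists 1; exact: norms_ub.
Qed.

(** Since [Q] is idempotent, A x = A (Q x), and the operator norm may be applied to [Q x] instead of
    [x]. Squared, this bounds |A x|^2 by sin^2 theta_p times the energy. *)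
Lemma hnorm_normal_op x : hnorm (A x) <= sp * hnorm (Q x).
Proof.
have -> : A x = A (Q x) by rewrite /A proj_perpK.
rewrite normal_op_opnorm; move: (Q x) => y.
have [->|y0] := eqVneq y 0.
  by rewrite hnorm0 mulr0 /A proj_perp_eq0 ?proj_id ?hnorm0//; exact: submod0.
have ny : 0 < hnorm y.
  rewrite lt_neqAle hnorm_ge0 andbT eq_sym.
  by apply: contra y0 => /eqP/hnorm_eq0 ->.
rewrite -ler_pdivrMr// mulrC.
have -> : (hnorm y)^-1 * hnorm (A y) = hnorm (A (inj (hnorm y)^-1 *: y)).
  by rewrite normal_opZ hnormZ ger0_norm// invr_ge0 ltW.
apply: ub_le_sup; first by exists 1; exact: norms_ub.
exists (inj (hnorm y)^-1 *: y) => //=.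
by rewrite hnormZ ger0_norm ?invr_ge0 ?hnorm_ge0// mulVf// gt_eqF.
Qed.

(** * Contraction of the energy in one step *)

Section Rate.
Variables lam Lam : R.
Hypotheses (lam0 : 0 < lam) (Lam0 : 0 <= Lam).
Hypothesis lower : forall x, U0 x -> lam * rdot x x <= rdot (Q x) (Q x).
Hypothesis upper : forall x, rdot (A x) (A x) <= Lam * rdot (Q x) (Q x).

(** By Cauchy-Schwarz, |Q x|^2 = <A x, x> <= |A x| |x|; squaring and inserting lam |x|^2 <= |Q x|^2
    leaves a common factor |Q x|^2 to cancel. *)
Lemma normal_op_lower x : U0 x -> lam * rdot (Q x) (Q x) <= rdot (A x) (A x).
Proof.
move=> U0x; set a := rdot (Q x) (Q x); set b := rdot (A x) (A x).
have a0 : 0 <= a := rdot_ge0 _.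
have b0 : 0 <= b := rdot_ge0 _.
have ab : a ^+ 2 <= b * rdot x x.
  have := rdot_le (A x) x; rewrite normal_op_dot; last exact: U0x.1.
  move=> h; rewrite /b -!hnorm_sqr -exprMn.
  by rewrite ler_pXn2r ?nnegrE ?mulr_ge0 ?hnorm_ge0.
have [->|a_neq0] := eqVneq a 0; first by rewrite mulr0.
have a_gt0 : 0 < a by rewrite lt_neqAle eq_sym a_neq0.
have := lower U0x; rewrite -/a => h.
rewrite -(ler_pM2r a_gt0).
have : lam * a ^+ 2 <= b * (lam * rdot x x) by rewrite [leRHS]mulrCA ler_pM2l.
have : b * (lam * rdot x x) <= b * a by rewrite ler_wpM2l.
by rewrite -mulrA -expr2; by move=> p q; exact: le_trans q p.
Qed.

(* Morally (A - lam)(Lam - A) >= 0, without spectral theory: the lower bound at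
   (A - Lam) x plus the upper bound at (A - lam) x is Lam - lam times the claim.
   The case Lam <= lam is degenerate, both bounds being equalities there. *)
Lemma normal_op_moments x : U0 x ->
  rdot (Q (A x)) (Q (A x)) + lam * Lam * rdot (Q x) (Q x) <=
  (lam + Lam) * rdot (A x) (A x).
Proof.
move=> U0x; have [UA _] := normal_op_in x.
(* The moments: [m1] to [m4] are <A^k x, x> for k = 1, ..., 4. *)
pose m1 := rdot (Q x) (Q x); pose m2 := rdot (A x) (A x).
pose m3 := rdot (Q (A x)) (Q (A x)); pose m4 := rdot (A (A x)) (A (A x)).
have m2E : rdot (Q (A x)) (Q x) = m2.
  by rewrite rdotC -normal_op_dot.
have m3E : rdot (A (A x)) (A x) = m3 by rewrite normal_op_dot.
have QE t : rdot (Q (A x - inj t *: x)) (Q (A x - inj t *: x)) =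
    m3 - 2 * t * m2 + t ^+ 2 * m1.
  by rewrite proj_perpB proj_perpZ rdot_subZ m2E.
have AE t : rdot (A (A x - inj t *: x)) (A (A x - inj t *: x)) =
    m4 - 2 * t * m3 + t ^+ 2 * m2.
  by rewrite normal_opB normal_opZ rdot_subZ m3E.
have U0A t : U0 (A x - inj t *: x).
  apply: submodB => //; [exact: normal_op_in|exact: submodZ].
rewrite -/m1 -/m2 -/m3.
have claim Lam' : lam < Lam' -> Lam <= Lam' ->
    m3 + lam * Lam' * m1 <= (lam + Lam') * m2.
  move=> lamL LamL.
  have := normal_op_lower (U0A Lam'); rewrite QE AE => h1.
  have h2 : rdot (A (A x - inj lam *: x)) (A (A x - inj lam *: x)) <=
      Lam' * rdot (Q (A x - inj lam *: x)) (Q (A x - inj lam *: x)).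
    by apply: le_trans (upper _) _; rewrite ler_wpM2r// rdot_ge0.
  move: h2; rewrite QE AE => h2.
  have L0 : 0 < Lam' - lam by rewrite subr_gt0.
  rewrite -(ler_pM2l L0); lra.
have m21 : lam * m1 <= m2 := normal_op_lower U0x.
have m21' : m2 <= Lam * m1 := upper x.
have m10 : 0 <= m1 := rdot_ge0 _.
have [lamL|Llam] := ltP lam Lam; first exact: claim.
have m2m1 : m2 = lam * m1.
  by have := mulr_ge0 (ltW lam0) m10; have := ler_wpM2r m10 Llam; lra.
(* With m2 = lam m1 the inequality reads m3 <= lam^2 m1 for every value of [Lam], so any admissible
   [Lam'] yields it. *)
have := claim (lam + 1); rewrite m2m1 ltrDl ltr01 => /(_ isT).
by move=> /(_ (le_trans Llam _)); rewrite lerDl ler01 => /(_ isT); lra.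
Qed.

Lemma steepest_descent_energy x t : U0 x -> A x != 0 ->
  t = rdot (A x) (A x) / rdot (Q (A x)) (Q (A x)) ->
  rdot (Q (x - inj t *: A x)) (Q (x - inj t *: A x)) <=
  ((Lam - lam) / (Lam + lam)) ^+ 2 * rdot (Q x) (Q x).
Proof.
move=> U0x A0 tE.
pose a := rdot (Q x) (Q x); pose b := rdot (A x) (A x).
pose k := rdot (Q (A x)) (Q (A x)).
have U0A := normal_op_in x.
have k0 : 0 < k.
  apply: lt_le_trans (lower U0A); rewrite mulr_gt0// lt_neqAle rdot_ge0 andbT.
  by apply: contra A0; rewrite eq_sym => /eqP/rdot_eq0 ->.
(* Exact line search: the energy along the step is a - 2 t b + t^2 k, and t = b / k is its
   minimiser. *)
have -> : rdot (Q (x - inj t *: A x)) (Q (x - inj t *: A x)) = a - b ^+ 2 / k.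
  rewrite proj_perpB proj_perpZ rdot_subZ.
  rewrite -(normal_op_dot x U0A.1) -/a -/b -/k tE -/b -/k.
  by field; rewrite gt_eqF.
have L0 : 0 < Lam + lam by rewrite ltr_wpDl.
have : k + lam * Lam * a <= (lam + Lam) * b := normal_op_moments U0x.
rewrite -/a => h.
have a0 : 0 <= a := rdot_ge0 _.
have h2 : (k + lam * Lam * a) ^+ 2 <= ((lam + Lam) * b) ^+ 2.
  rewrite ler_pXn2r// nnegrE.
    by rewrite addr_ge0 ?(ltW k0)// !mulr_ge0// ltW.
  by rewrite mulr_ge0 ?rdot_ge0// addr_ge0// ltW.
rewrite -subr_ge0.
have -> : ((Lam - lam) / (Lam + lam)) ^+ 2 * a - (a - b ^+ 2 / k) =
    (((lam + Lam) * b) ^+ 2 - 4 * (lam * Lam * a) * k) / ((Lam + lam) ^+ 2 * k).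
  by field; rewrite !gt_eqF.
apply: divr_ge0; last by rewrite mulr_ge0 ?sqr_ge0// ltW.
(* AM-GM: 4 (lam Lam a) k <= (k + lam Lam a)^2, which [h2] bounds further. *)
have := sqr_ge0 (k - lam * Lam * a); nra.
Qed.

End Rate.

(** * The set of best approximations and the error of the iteration *)

Section BestApproximation.
Context {W : set H} {w : H}.
Hypothesis WE : W = [set w + v | v in V].
Hypothesis cos_lt1 : c < 1.

Lemma sub_orth_proj_affine x : x - orth_proj ip W x = Q (x - w).
Proof.
suff -> : orth_proj ip W x = w + orth_proj ip V (x - w).
  by rewrite opprD addrA.
have Vp := proj_in Vlin Vcl (x - w).
apply: orth_proj_unique; first by rewrite WE; exists (orth_proj ip V (x - w)).
move=> s; rewrite WE => -[v Vv <-].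
have -> : x - (w + orth_proj ip V (x - w)) = Q (x - w).
  by rewrite opprD addrA.
rewrite [in X in ip _ X]opprD addrACA subrr add0r.
by apply: (ip_eq0 Vlin (proj_perp_dot (x - w))); exact: submodB.
Qed.

(** Minimise |Q (x - w)| over [U0], where [c < 1] makes it coercive; over all of [U], directions in
    [V] would spoil this. As [A (z - w)] lies in [U0], it is an admissible variation, and
    stationarity along it says |A (z - w)|^2 = 0. *)
Lemma exists_critical_point : exists2 z, U z & A (z - w) = 0.
Proof.
have /andP[c0 _] := cos_friedrichs_itv.
have lam0 : 0 < 1 - c ^+ 2 by rewrite subr_gt0 expr_lt1.
have slam0 : 0 < Num.sqrt (1 - c ^+ 2) by rewrite sqrtr_gt0.
have gB x y : Q (x - w) - Q (y - w) = Q (x - y).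
  by rewrite -proj_perpB; congr Q; rewrite opprB addrA subrK.
have [|x y U0x U0y|x y _ _|x y U0x U0y|x y|z U0z zmin] :=
    @exists_minimizer U0 (fun x => Q (x - w)) _ slam0 _ U0cl.
- by exists 0; exact: submod0.
- by apply: submodZ => //; exact: submodD.
- rewrite -proj_perpD -proj_perpZ; congr Q.
  rewrite addrACA -opprD -mulr2n -(scaler_nat 2 w) scalerBr scalerA.
  by rewrite -(rmorph_nat inj) -rmorphM mulVf ?pnatr_eq0// rmorph1 scale1r.
- rewrite gB -(@ler_pXn2r _ 2)// ?nnegrE ?mulr_ge0 ?sqrtr_ge0 ?hnorm_ge0//.
  rewrite exprMn (sqr_sqrtr (ltW lam0)) !hnorm_sqr proj_perp_coercive//.
  exact: submodB.
- by rewrite gB; exact: hnorm_proj_perp.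
exists z; first exact: U0z.1.
apply: rdot_eq0; rewrite normal_op_dot; last exact: (normal_op_in _).1.
apply: minimizer_orthogonal => t.
apply: le_trans (zmin (z + inj t *: A (z - w)) _) _.
  by apply: submodD => //; apply: submodZ => //; exact: normal_op_in.
by rewrite addrAC (proj_perpD (z - w)) proj_perpZ.
Qed.

Context {z : H}.
Hypotheses (Uz : U z) (zcrit : A (z - w) = 0).

(** For [x] in [U], criticality of [z] makes Q (z - w) and Q (x - z) orthogonal, so by Pythagoras
    the distance from [x] to [W] is least exactly when Q (x - z) = 0. *)
Lemma best_approxE : best_approx re ip U W = [set x | U x /\ Q (x - z) = 0].
Proof.
have pyth x : U x -> hnorm (Q (x - w)) ^+ 2 =
    hnorm (Q (z - w)) ^+ 2 + hnorm (Q (x - z)) ^+ 2.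
  move=> Ux; have -> : Q (x - w) = Q (z - w) + Q (x - z).
    by rewrite -proj_perpD; congr Q; rewrite [RHS]addrC subrKA.
  have : rdot (Q (z - w)) (Q (x - z)) = 0.
    by rewrite -normal_op_dot ?zcrit ?rdot0l//; exact: submodB.
  by rewrite !hnorm_sqr rdot_sqrD => ->; rewrite mulr0 addr0.
have infE : inf [set hnorm (v - orth_proj ip W v) | v in U] = hnorm (Q (z - w)).
  have lbz : lbound [set hnorm (v - orth_proj ip W v) | v in U]
      (hnorm (Q (z - w))).
    move=> _ [v Uv <-]; rewrite sub_orth_proj_affine.
    rewrite -(@ler_pXn2r _ 2)// ?nnegrE ?hnorm_ge0// (pyth v Uv).
    by rewrite lerDl sqr_ge0.
  apply/eqP; rewrite eq_le lb_le_inf ?andbT//; last first.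
    by eexists; exists z.
  apply: ge_inf; first by eexists; exact: lbz.
  by exists z; rewrite ?sub_orth_proj_affine.
rewrite /best_approx infE.
apply/seteqP; split => x [Ux]; rewrite /=  sub_orth_proj_affine => xz.
  split=> //; apply: hnorm_eq0; apply/eqP; rewrite -sqrf_eq0; apply/eqP.
  by have := pyth x Ux; rewrite xz; lra.
split=> //; apply/eqP; rewrite -(@eqrXn2 _ 2) ?hnorm_ge0//.
by rewrite (pyth x Ux) xz hnorm0 expr0n addr0.
Qed.

Lemma orth_proj_best_approx x : U x ->
  orth_proj ip (best_approx re ip U W) x = z + orth_proj ip (U `&` V) (x - z).
Proof.
move=> Ux; have [Un Vn] := proj_in Nlin Ncl (x - z).
rewrite best_approxE; apply: orth_proj_unique => [|s [Us sz]].
  by split; [exact: submodD|rewrite addrC addKr proj_perp_eq0].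
have sub y n : y - (z + n) = y - z - n by rewrite opprD addrA.
rewrite !sub; apply: (ip_eq0 Nlin (proj_orth Nlin Ncl (x - z))).
apply: submodB => //; split; first exact: submodB.
(* A vector killed by [Q] equals its projection onto [V]; so the best approximations form [z] plus
   the intersection of [U] and [V]. *)
have : s - z = orth_proj ip V (s - z) + Q (s - z) by rewrite [RHS]addrC subrK.
by rewrite sz addr0 => ->; exact: proj_in.
Qed.

Lemma steepest_descent_error (u : nat -> H) (alpha : nat -> K) :
  U (u 0%N) ->
  let r n := u n - P (orth_proj ip W (u n)) in
  (forall n, r n != 0 ->
    alpha n = `|r n| ^+ 2 / `|orth_proj ip (orthocompl ip V) (r n)| ^+ 2) ->
  (forall n, u n.+1 = if r n == 0 then u n else u n - alpha n *: r n) ->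
  let e n := u n - orth_proj ip (best_approx re ip U W) (u 0%N) in
  let kappa := sp / Num.sqrt (1 - c ^+ 2) in
  forall n, hnorm (e n) <=
    kappa * (1 - 2 / (kappa ^+ 2 + 1)) ^+ n * hnorm (e 0%N).
Proof.
move=> u0U r alphaE uS e kappa.
have /andP[c0 _] := cos_friedrichs_itv.
have /andP[s0 _] := opnorm_itv.
set lam := 1 - c ^+ 2; have lam0 : 0 < lam by rewrite subr_gt0 expr_lt1.
pose Lam := sp ^+ 2; have Lam0 : 0 <= Lam := sqr_ge0 _.
have upper x : rdot (A x) (A x) <= Lam * rdot (Q x) (Q x).
  rewrite -!hnorm_sqr -exprMn ler_pXn2r ?nnegrE ?mulr_ge0 ?hnorm_ge0//.
  exact: hnorm_normal_op.
have lower := proj_perp_coercive.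
have [Un Vn] := proj_in Nlin Ncl (u 0%N - z).
have eE n : e n = u n - z - orth_proj ip (U `&` V) (u 0%N - z).
  by rewrite /e orth_proj_best_approx// opprD addrA.
(* The point subtracted in [e n] is [z] shifted along the intersection of [U] and [V], where [Q]
   vanishes. With A (z - w) = 0, the residual A (u n - w) reduces to A (e n). *)
have rE n : U (u n) -> r n = A (e n).
  move=> Uu; rewrite eE normal_opB [X in _ - X]/A (proj_perp_eq0 Vn).
  rewrite (proj_id Ulin (submod0 Ulin)) subr0.
  have -> : u n - z = (u n - w) - (z - w) by rewrite opprB addrA subrK.
  rewrite normal_opB zcrit subr0 /A -sub_orth_proj_affine projB//.
  by rewrite (proj_id Ulin Uu).
(* The initial error is the residual of a projection onto the intersection of [U] and [V], hence
   orthogonal to it; each step then subtracts a multiple of A (e n). *)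
have eU0 n : U (u n) /\ U0 (e n).
  elim: n => [|n [Uu U0e]].
    split=> //; rewrite eE; split.
      by apply: submodB => //; exact: submodB.
    by move=> t; apply: (ip_eq0 Nlin) => {t} s; exact: proj_orth.
  have eS : e n.+1 = if r n == 0 then e n else e n - alpha n *: r n.
    by rewrite /e uS; case: ifP => // _; rewrite addrAC.
  rewrite eS uS; case: ifP => // _; rewrite rE//.
  have U0A := normal_op_in (e n).
  split; first by apply: submodB => //; apply: submodZ => //; exact: U0A.1.
  by apply: submodB => //; exact: submodZ.
set rho := (Lam - lam) / (Lam + lam).
have L0 : 0 < Lam + lam by rewrite ltr_wpDl.
have energy n : rdot (Q (e n)) (Q (e n)) <=
    rho ^+ (2 * n) * rdot (Q (e 0%N)) (Q (e 0%N)).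
  elim: n => [|n IH]; first by rewrite muln0 expr0 mul1r.
  have [Uu U0e] := eU0 n.
  rewrite mulnS exprD -mulrA; apply: le_trans (ler_wpM2l (sqr_ge0 rho) IH).
  rewrite {1 2}/e uS; case: ifP => [/eqP rn0|/negbT rn0].
    (* Terminated iteration: A (e n) = 0 forces the energy to vanish. *)
    have := normal_op_lower lam0 lower U0e; rewrite -rE// rn0 rdot0l.
    rewrite pmulr_rle0// => Qe0.
    by apply: le_trans Qe0 _; rewrite mulr_ge0 ?sqr_ge0// rdot_ge0.
  rewrite addrAC -/(e n) alphaE// (proj_compl Vlin Vcl) -/(Q (r n)).
  rewrite -!inj_rdot -fmorph_div rE//.
  apply: (steepest_descent_energy lam0 Lam0 lower upper U0e) => //.
  by rewrite -rE.
move=> n; have [_ U0e] := eU0 n.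
have [_ U0e0] := eU0 0%N.
have kappa2 : kappa ^+ 2 = Lam / lam.
  by rewrite expr_div_n (sqr_sqrtr (ltW lam0)).
have -> : 1 - 2 / (kappa ^+ 2 + 1) = rho.
  by rewrite kappa2 /rho; field; rewrite !gt_eqF.
have kappa0 : 0 <= kappa by rewrite divr_ge0 ?sqrtr_ge0.
(* From |Q e|^2 = <A e, e> <= |A e| |e| <= sp |Q e| |e|, after dividing by |Q e|. *)
have Qe0 : rdot (Q (e 0%N)) (Q (e 0%N)) <= Lam * rdot (e 0%N) (e 0%N).
  set a := rdot (Q _) _.
  have : a <= hnorm (A (e 0%N)) * hnorm (e 0%N).
    by rewrite /a -(normal_op_dot _ U0e0.1) rdot_le.
  have := ler_wpM2r (hnorm_ge0 (e 0%N)) (hnorm_normal_op (e 0%N)).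
  have aE : a = hnorm (Q (e 0%N)) ^+ 2 by rewrite hnorm_sqr.
  move=> h1 h2; have {h1 h2} := le_trans h2 h1; rewrite {1}aE => h.
  rewrite aE -hnorm_sqr -exprMn ler_pXn2r ?nnegrE ?mulr_ge0 ?hnorm_ge0//.
  have [->|Q0] := eqVneq (hnorm (Q (e 0%N))) 0.
    by rewrite mulr_ge0 ?hnorm_ge0.
  have Q_gt0 : 0 < hnorm (Q (e 0%N)) by rewrite lt_neqAle eq_sym Q0 hnorm_ge0.
  by rewrite -(ler_pM2r Q_gt0) -expr2 mulrAC.
(* If [U0] is trivial, [Lam] is 0 and [rho] negative; a nonzero initial error forces lam <= Lam and
   thus rho >= 0. *)
have [e00|e00] := eqVneq (e 0%N) 0.
  suff -> : e n = 0 by rewrite e00 hnorm0 mulr0.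
  apply: rdot_eq0; apply/eqP; rewrite eq_le rdot_ge0 andbT.
  rewrite -(pmulr_rle0 _ lam0); apply: le_trans (lower _ U0e) _.
  apply: le_trans (energy n) _.
  by rewrite e00 proj_perp_eq0 ?rdot0l ?mulr0//; exact: submod0.
have rho0 : 0 <= rho.
  have e0_gt0 : 0 < rdot (e 0%N) (e 0%N).
    rewrite lt_neqAle rdot_ge0 andbT; apply: contra e00; rewrite eq_sym.
    by move=> /eqP/rdot_eq0 ->.
  have := le_trans (lower _ U0e0) Qe0; rewrite ler_pM2r// => lL.
  by rewrite divr_ge0 ?subr_ge0// ltW.
(* Squared, the bound is the chain lam |e n|^2 <= |Q (e n)|^2 <= rho^(2n) |Q (e 0)|^2 <= rho^(2n)
   Lam |e 0|^2. *)
rewrite -(@ler_pXn2r _ 2)// ?nnegrE ?mulr_ge0 ?exprn_ge0 ?hnorm_ge0//.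
rewrite 2!exprMn kappa2 -exprM (mulnC n) !hnorm_sqr.
rewrite -(ler_pM2l lam0); apply: le_trans (lower _ U0e) _.
apply: le_trans (energy n) _.
have -> : lam * (Lam / lam * rho ^+ (2 * n) * rdot (e 0%N) (e 0%N)) =
    rho ^+ (2 * n) * (Lam * rdot (e 0%N) (e 0%N)).
  by field; rewrite gt_eqF.
by rewrite ler_wpM2l// exprn_ge0.
Qed.

End BestApproximation.

End FriedrichsAngle.

End RealPart.

(** * The error bound in terms of the angles *)

Theorem proposition6p8 (R : realType) (K : numFieldType) (cnj : K -> K)
    (re : K -> R) (scalars : real_or_complex cnj re)
    (H : completeNormedModType K) (ip : {dot H for cnj})
    (ip_norm : forall x : H, `|x| ^+ 2 = ip x x)
    (U V W : set H)
    (closedU : closed_linear_subspace U) (closedW : closed_affine_subspace W V)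
    (theta_f_gt0 : 0 < theta_f re ip U V)
    (u r : nat -> H) (alpha : nat -> K)
    (u0U : U (u 0%N))
    (rE : forall n, r n = u n - orth_proj ip U (orth_proj ip W (u n)))
    (alphaE : forall n, r n != 0 ->
       alpha n = `|r n| ^+ 2 / `|orth_proj ip (orthocompl ip V) (r n)| ^+ 2)
    (uS : forall n,
       u n.+1 = if r n == 0 then u n else u n - alpha n *: r n) :
  let e n := u n - orth_proj ip (best_approx re ip U W) (u 0%N) in
  let kappa := sin (theta_p re ip U V) / sin (theta_f re ip U V) in
  forall n, hnorm re (e n) <=
    kappa * (1 - 2 / (kappa ^+ 2 + 1)) ^+ n * hnorm re (e 0%N).
Proof.
move=> e kappa.
have [inj reP] := real_or_complex_real_part scalars.
have [Ulin /(closed_dclosed reP) Ucl] := closedU.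
have [/(closed_dclosed reP) Wcl Vlin [w WE]] := closedW.
(* [V] inherits closedness from its translate [W]. *)
have Vcl : dclosed (re := re) V.
  move=> x xV; have : W (w + x).
    apply: Wcl => eps /xV[v Vv xv]; exists (w + v).
      by rewrite WE; exists v.
    by rewrite opprD addrACA subrr add0r.
  by rewrite WE => -[v Vv /addrI <-].
have /andP[c0 c1] := cos_friedrichs_itv (U := U) (V := V) reP ip_norm.
(* A cosine equal to 1 would make the Friedrichs angle 0. *)
have c_lt1 : cos_friedrichs re ip U V < 1.
  rewrite lt_neqAle c1 andbT; apply: contraTneq theta_f_gt0 => cE.
  by rewrite /theta_f cE acos1 ltxx.
have /andP[s0 s1] := opnorm_itv reP ip_norm Ulin Ucl Vlin Vcl.
have kappaE : kappa =
    opnorm re (orth_proj ip U \o orth_proj ip (orthocompl ip V)) /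
    Num.sqrt (1 - cos_friedrichs re ip U V ^+ 2).
  rewrite /kappa /theta_p /theta_f sin_acos ?c1 ?andbT; last by lra.
  by rewrite asinK// in_itv /= s1 andbT; lra.
have [z Uz zcrit] :=
  exists_critical_point (w := w) reP ip_norm Ulin Ucl Vlin Vcl c_lt1.
have rE' : r = fun n => u n - orth_proj ip U (orth_proj ip W (u n)).
  exact/funext.
rewrite kappaE /e; subst r.
exact: (steepest_descent_error reP ip_norm Ulin Ucl Vlin Vcl WE c_lt1 Uz zcrit
  u0U alphaE uS).
Qed.
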